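(* Let $R$ be a commutative Noetherian domain, $I$ an ideal in $R$ and $n\in\mathbb{N}$ with $n\ge 1$. Consider the following algorithm (assuming primary decompositions with their associated primes can be computed and inclusions of ideals in $R$ can be decided). (1) Compute the associated primes $\mathfrak{p}_1,\ldots,\mathfrak{p}_r$ of $I$. (2) Compute a primary decomposition $I^n=\bigcap_{i=1}^m Q_i$ with associated primes $\mathfrak{q}_i:=\sqrt{Q_i}$. (3) For each $i\in\{1,\ldots,m\}$ set $\tilde Q_i:=Q_i$ if $\mathfrak{q}_i\subseteq\mathfrak{p}_j$ for some $j\in\{1,\ldots,r\}$, and $\tilde Q_i:=R$ otherwise. (4) Return $\tilde I:=\bigcap_{i=1}^m\tilde Q_i$. This algorithm terminates and is correct, i.e. $\tilde I=I^{(n)}$ is the $n$-th symbolic power of $I$.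
   Context: For an ideal $I$ of a Noetherian domain $R$ with primary decomposition $I=\bigcap_{j=1}^r Q'_j$ and associated primes $\mathfrak{p}_j=\sqrt{Q'_j}$, the $n$-th symbolic power of $I$ is $$I^{(n)}=\bigcap_{j=1}^{r}\bigl(R_{\mathfrak{p}_j}I^n\cap R\bigr),$$ where $R_{\mathfrak{p}_j}=(R\setminus\mathfrak{p}_j)^{-1}R$ is the localization of $R$ at the prime $\mathfrak{p}_j$. *)

(* Defs.v *)
From mathcomp Require Import all_boot all_algebra.
From mathcomp Require Import boolp classical_sets.

Set Implicit Arguments.
Unset Strict Implicit.
Unset Printing Implicit Defensive.

Import GRing.Theory.
Local Open Scope classical_set_scope.
Local Open Scope ring_scope.

(* MathComp's [idealr] predicates are boolean and exclude the unit ideal; here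
   an ideal is an arbitrary subset and may be the whole ring [setT]. *)
Definition ideal (R : comNzRingType) (I : set R) : Prop :=
  [/\ I 0, (forall x y, I x -> I y -> I (x + y))
    & (forall a x, I x -> I (a * x))].

(* The finite sums of products a * b with a in A and b in B.  It is used for the
   product of two ideals, for the ideal generated by a set (with A = setT), and
   for the extension of an ideal of R to a localization of R. *)
Definition mulset (S : comNzRingType) (A B : set S) : set S :=
  [set x | exists s : seq (S * S),
     (forall c, c \in s -> A c.1 /\ B c.2) /\ x = \sum_(c <- s) c.1 * c.2].

Fixpoint ideal_power (R : comNzRingType) (I : set R) (n : nat) : set R :=
  if n is m.+1 then mulset I (ideal_power I m) else setT.

Definition noetherian (R : comNzRingType) : Prop :=
  forall I : set R, ideal I -> exists s : seq R, I = mulset setT [set` s].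

Definition radical (R : comNzRingType) (I : set R) : set R :=
  [set x | exists n, I (x ^+ n)].

Definition primary_ideal (R : comNzRingType) (Q : set R) : Prop :=
  [/\ ideal Q, ~ Q 1 & forall x y, Q (x * y) -> Q x \/ radical Q y].

(* The empty intersection is setT, so the unit ideal has the empty primary
   decomposition. *)
Definition primary_decomposition (R : comNzRingType) (I : set R)
    (D : seq (set R)) : Prop :=
  (forall Q, Q \in D -> primary_ideal Q) /\ I = \big[setI/setT]_(Q <- D) Q.

Definition minimal_primary_decomposition (R : comNzRingType) (I : set R)
    (D : seq (set R)) : Prop :=
  [/\ primary_decomposition I D,
      uniq [seq radical Q | Q <- D]
    & forall Q, Q \in D -> ~ (\big[setI/setT]_(K <- D | K != Q) K `<=` Q)].

(* The radicals of the components of an arbitrary decomposition depend on that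
   decomposition; those of a minimal one do not (when one exists), so minimality
   is what makes the associated primes invariants of I. *)
Definition associated_prime (R : comNzRingType) (I p : set R) : Prop :=
  exists D, minimal_primary_decomposition I D /\
    exists2 Q, Q \in D & p = radical Q.

(* R_p = (R \ p)^-1 R, for a domain R and a prime p, as a subring of the field
   of fractions of R. *)
Definition localization (R : idomainType) (p : set R) : set {fraction R} :=
  [set z | exists a s : R, ~ p s /\ z = tofrac a / tofrac s].

Definition extension (R : idomainType) (p J : set R) : set {fraction R} :=
  mulset (localization p) [set tofrac x | x in J].

Definition contraction (R : idomainType) (Z : set {fraction R}) : set R :=
  [set x | Z (tofrac x)].

Definition symbolic_power (R : idomainType) (I : set R) (n : nat) : set R :=
  \bigcap_(p in [set p | associated_prime I p])
    contraction (extension p (ideal_power I n)).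

Definition computes_associated_primes (R : comNzRingType)
    (assp : set R -> seq (set R)) : Prop :=
  forall J, ideal J -> forall p, p \in assp J <-> associated_prime J p.

(* Returns the list of the pairs (Q, radical Q), for Q running over the
   components of some, not necessarily minimal, primary decomposition. *)
Definition computes_primary_decompositions (R : comNzRingType)
    (pdec : set R -> seq (set R * set R)) : Prop :=
  forall J, ideal J ->
    primary_decomposition J [seq c.1 | c <- pdec J] /\
    (forall c, c \in pdec J -> c.2 = radical c.1).

Definition decides_inclusion (R : comNzRingType)
    (incl : set R -> set R -> bool) : Prop :=
  forall J K, ideal J -> ideal K -> incl J K <-> J `<=` K.

(* The configurations of the algorithm.  In [Loop ps D Qt], [ps] is the list of
   the associated primes, [D] the list of the pairs (Q_i, q_i) still to be
   examined, and [Qt] the list of the ideals Q~_i already determined. *)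
Variant state (R : comNzRingType) : Type :=
| Start
| Primes of seq (set R)
| Loop of seq (set R) & seq (set R * set R) & seq (set R)
| Return of set R.
Arguments Start {R}.

Section Algorithm.
Variables (R : comNzRingType) (assp : set R -> seq (set R)).
Variables (pdec : set R -> seq (set R * set R)) (incl : set R -> set R -> bool).
Variables (I : set R) (n : nat).

Definition step (s : state R) : state R :=
  match s with
  | Start => Primes (assp I)
  | Primes ps => Loop ps (pdec (ideal_power I n)) [::]
  | Loop ps ((Q, q) :: D) Qt =>
      Loop ps D (rcons Qt (if has (incl q) ps then Q else setT))
  | Loop ps [::] Qt => Return (\big[setI/setT]_(Q <- Qt) Q)
  | Return J => Return J
  end.

Definition returns (J : set R) : Prop :=
  exists k, iter k step Start = Return J.

End Algorithm.

(* Main.v *)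
Require Import Defs.
From mathcomp Require Import all_boot all_algebra.
From mathcomp Require Import boolp classical_sets.

(** The algorithm visits the components of a finite primary decomposition of
    [I^n] one after the other, so it stops; what it returns is the intersection
    of the components [Q] of [I^n] such that [radical Q] lies below some
    associated prime of [I] ([returns_kept_components]).

    Correctness is a statement about one prime [p] at a time: localizing an
    ideal [J] at [p] and contracting it back keeps exactly the primary
    components of [J] whose radical is contained in [p]
    ([contraction_extension_primary]).  After clearing denominators, [x] lies in
    [R_p J], intersected with [R], iff [s * x] lies in [J] for some [s] outside
    [p] ([contraction_extensionP]).  If [radical Q] is contained in [p], such an
    [s] is outside [radical Q] and cancels modulo the primary ideal [Q].  If
    not, some power of an element of [radical Q] outside [p] lies in [Q] and
    still avoids [p]; since [p] is prime, the product of these powers over all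
    the components to be discarded is a legitimate denominator, and it
    multiplies the intersection of the remaining components into [J].

    Intersecting over all associated primes [p] of [I], a component [Q] of [I^n]
    imposes a condition on the symbolic power iff [radical Q] is contained in at
    least one of them, which is the test made by the algorithm. *)

Set Implicit Arguments.
Unset Strict Implicit.
Unset Printing Implicit Defensive.

Import GRing.Theory.
Local Open Scope classical_set_scope.
Local Open Scope ring_scope.

(** * Ideals, radicals and primes *)

Lemma ideal_sum (R : comNzRingType) (J : set R) (T : eqType) (s : seq T)
    (F : T -> R) :
  ideal J -> (forall i, i \in s -> J (F i)) -> J (\sum_(i <- s) F i).
Proof.
move=> [J0 JD _] JF; rewrite big_seq.
by apply: (big_ind J) => // x y; apply: JD.
Qed.

Lemma mulset_ideal (R : comNzRingType) (A B : set R) :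
  ideal B -> ideal (mulset A B).
Proof.
move=> [_ _ BM]; split.
- by exists [::]; rewrite big_nil.
- move=> _ _ [s [sP ->]] [t [tP ->]]; exists (s ++ t); rewrite big_cat.
  by split=> // c; rewrite mem_cat => /orP[/sP|/tP].
- move=> a _ [s [sP ->]]; exists [seq (c.1, a * c.2) | c <- s]; split.
    by move=> _ /mapP[c /sP[Ac Bc] ->]; split=> //; apply: BM.
  by rewrite big_map mulr_sumr; apply: eq_bigr => c _; rewrite mulrCA.
Qed.

Lemma ideal_power_ideal (R : comNzRingType) (I : set R) n :
  ideal (ideal_power I n).
Proof. by elim: n => [|n IHn] /=; [split | apply: mulset_ideal]. Qed.

Lemma bigsetI_seqP (T : choiceType) (U : Type) (s : seq T) (F : T -> set U) x :
  (\big[setI/setT]_(i <- s) F i) x <-> forall i, i \in s -> F i x.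
Proof. by rewrite -bigcap_seq. Qed.

Lemma radical_ideal (R : comNzRingType) (J : set R) :
  ideal J -> ideal (radical J).
Proof.
move=> idJ; have [J0 _ JM] := idJ.
have JX x m k : J (x ^+ m) -> (m <= k)%N -> J (x ^+ k).
  by move=> Jx mk; rewrite -(subnK mk) exprD; apply: JM.
split.
- by exists 1%N; rewrite expr1.
- (* In each term of the binomial expansion of (x + y) ^+ (m + k), either the
     exponent of x is at least m or that of y is at least k. *)
  move=> x y [m Jx] [k Jy]; exists (m + k)%N; rewrite exprDn.
  apply: ideal_sum => // i _; rewrite -mulr_natl; apply: (JM).
  have [ki|/ltnW ik] := leqP k i; first by apply: (JM); apply: JX Jy ki.
  by rewrite mulrC; apply: (JM); apply: JX Jx _; rewrite -addnBA ?leq_addr.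
- by move=> a x [m Jx]; exists m; rewrite exprMn; apply: JM.
Qed.

Definition prime_ideal (R : comNzRingType) (p : set R) : Prop :=
  [/\ ideal p, ~ p 1 & forall x y, p (x * y) -> p x \/ p y].

Lemma radical_primary_prime (R : comNzRingType) (Q : set R) :
  primary_ideal Q -> prime_ideal (radical Q).
Proof.
move=> [idQ Q1 Qprim]; split; first exact: radical_ideal.
  by move=> [m]; rewrite expr1n.
move=> x y [m]; rewrite exprMn => /Qprim[Qx|[k Qy]]; first by left; exists m.
by right; exists (m * k)%N; rewrite exprM.
Qed.

Lemma associated_prime_prime (R : comNzRingType) (I p : set R) :
  associated_prime I p -> prime_ideal p.
Proof.
by move=> [D [[[prD _] _ _] [Q /prD QD ->]]]; apply: radical_primary_prime.
Qed.

Lemma prime_notinM (R : comNzRingType) (p : set R) x y :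
  prime_ideal p -> ~ p x -> ~ p y -> ~ p (x * y).
Proof. by move=> [_ _ pM] px py /pM[]. Qed.

Lemma prime_notinX (R : comNzRingType) (p : set R) x m :
  prime_ideal p -> ~ p x -> ~ p (x ^+ m).
Proof.
move=> pp px; elim: m => [|m IHm]; first by case: pp.
by rewrite exprS; apply: prime_notinM.
Qed.

(** * Localization at a prime *)

Lemma tofrac_notin_prime (R : idomainType) (p : set R) s :
  prime_ideal p -> ~ p s -> tofrac s != 0.
Proof.
by move=> [[p0 _ _] _ _] ps; rewrite tofrac_eq0; apply: contra_notN ps => /eqP->.
Qed.

(** Any finite sum of fractions has a common denominator, and the complement of
    a prime is closed under products; so each element of [R_p J] is a single
    fraction with numerator in [J]. *)
Lemma extensionP (R : idomainType) (p J : set R) z :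
  prime_ideal p -> ideal J ->
  extension p J z <->
  exists a s, [/\ J a, ~ p s & z = tofrac a / tofrac s].
Proof.
move=> pp [J0 JD JM]; have [_ p1 _] := pp.
split=> [[cs [csP ->]]|[a [s [Ja ps ->]]]]; last first.
  exists [:: (tofrac 1 / tofrac s, tofrac a)]; split; last first.
    by rewrite big_seq1 /= tofrac1 mulrC mul1r.
  move=> c; rewrite inE => /eqP -> /=; split; last by exists a.
  by exists 1, s.
rewrite big_seq; elim/big_ind: _ => [|x y|c /csP].
- by exists 0, 1; rewrite tofrac0 mul0r.
- move=> [a [s [Ja ps ->]]] [b [t [Jb pt ->]]]; exists (a * t + b * s), (s * t).
  split; last by rewrite addf_div ?(tofrac_notin_prime pp) // tofracD !tofracM.
    by apply: JD; rewrite mulrC; apply: JM.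
  exact: prime_notinM.
- move=> [[a [s [ps ->]]] [b Jb <-]]; exists (a * b), s; split=> //.
    exact: JM.
  by rewrite tofracM mulrAC.
Qed.

Lemma contraction_extensionP (R : idomainType) (p J : set R) x :
  prime_ideal p -> ideal J ->
  contraction (extension p J) x <-> exists2 s, ~ p s & J (s * x).
Proof.
move=> pp idJ.
rewrite /contraction /=; rewrite extensionP //.
split=> [[a [s [Ja ps]]] xE|[s ps Jsx]]; last first.
  by exists (s * x), s; split=> //; rewrite tofracM mulrC mulKf ?(tofrac_notin_prime pp).
exists s => //; suff -> : s * x = a by [].
by apply/eqP; rewrite -tofrac_eq tofracM xE mulrC divfK ?(tofrac_notin_prime pp).
Qed.

(** Each [Q] whose radical is not contained in [p] contains a power of some
    element outside [p]; the product of these powers works for all such [Q] at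
    once, and avoids [p] because [p] is prime. *)
Lemma common_multiplier (R : comNzRingType) (p : set R) (D : seq (set R)) :
  prime_ideal p -> (forall Q, Q \in D -> ideal Q) ->
  exists2 s, ~ p s & forall Q, Q \in D -> ~ radical Q `<=` p -> Q s.
Proof.
move=> pp; elim: D => [|Q D IHD] idD; first by exists 1 => //; case: pp.
have [s ps sD] := IHD (fun K KD => idD K (mem_behead (s := Q :: D) KD)).
have idM K a b : K \in Q :: D -> K b -> K (a * b).
  by move=> /idD[_ _]; apply.
have [Qp|] := pselect (radical Q `<=` p).
  by exists s => // K; rewrite inE => /predU1P[->|/sD].
move=> /existsNP[t /not_implyP[[m Qt] pt]]; exists (t ^+ m * s).
  by apply: prime_notinM => //; apply: prime_notinX.
move=> K KD Kp; have := KD; rewrite inE => /predU1P[KQ|/sD Ks].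
  by rewrite mulrC; apply: idM => //; rewrite KQ.
by apply: idM => //; apply: Ks.
Qed.

(** A component [Q] with [radical Q `<=` p] survives because a denominator,
    being outside [radical Q], cancels modulo [Q]; the others disappear because
    one denominator lies in all of them. *)
Lemma contraction_extension_primary (R : idomainType) (p J : set R) D x :
  prime_ideal p -> ideal J -> primary_decomposition J D ->
  contraction (extension p J) x <->
  forall Q, Q \in D -> radical Q `<=` p -> Q x.
Proof.
move=> pp idJ [prD JE]; rewrite contraction_extensionP //.
split=> [[s ps + Q QD Qp]|xD].
  rewrite JE => /bigsetI_seqP/(_ Q QD); have [_ _ Qprim] := prD _ QD.
  by rewrite mulrC => /Qprim[//|/Qp].
have idD Q : Q \in D -> ideal Q by move=> /prD[].
have [s ps sD] := common_multiplier pp idD.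
exists s => //; rewrite JE; apply/bigsetI_seqP => Q QD.
have [_ _ QM] := idD _ QD.
have [Qp|Qp] := pselect (radical Q `<=` p); first by apply: QM; apply: xD.
by rewrite mulrC; apply: QM; apply: sD.
Qed.

(** * The algorithm *)

Section Run.
Variables (R : comNzRingType) (assp : set R -> seq (set R)).
Variables (pdec : set R -> seq (set R * set R)) (incl : set R -> set R -> bool).
Variables (I : set R) (n : nat).

Local Notation step := (step assp pdec incl I n).
Local Notation returns := (returns assp pdec incl I n).

(** The state [Return J] is a fixed point of [step], so a longer run cannot
    reach another one. *)
Lemma returns_unique J K : returns J -> returns K -> J = K.
Proof.
have stop m L : iter m step (Return L) = Return L.
  by elim: m => //= m ->.
move=> [k kJ] [m mK].
have : iter (m + k) step Start = iter (k + m) step Start by rewrite addnC.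
by rewrite !iterD kJ mK !stop => -[].
Qed.

Lemma iter_loop ps D Qt :
  iter (size D) step (Loop ps D Qt) =
  Loop ps [::]
    (Qt ++ [seq if has (incl c.2) ps then c.1 else setT | c <- D]).
Proof.
elim: D Qt => [|[Q q] D IHD] Qt; first by rewrite cats0.
by rewrite [size _]/= iterSr IHD cat_rcons.
Qed.

Lemma returns_kept_components :
  returns (\big[setI/setT]_(c <- pdec (ideal_power I n))
             if has (incl c.2) (assp I) then c.1 else setT).
Proof.
(* Two steps lead from [Start] to the loop, and one from its end to [Return]. *)
exists (size (pdec (ideal_power I n))).+3.
by rewrite iterS !iterSr iter_loop /= big_map.
Qed.

End Run.

Theorem proposition22 (R : idomainType) (noethR : noetherian R)
    (assp : set R -> seq (set R)) (pdec : set R -> seq (set R * set R))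
    (incl : set R -> set R -> bool)
    (asspP : computes_associated_primes assp)
    (pdecP : computes_primary_decompositions pdec)
    (inclP : decides_inclusion incl)
    (I : set R) (idealI : ideal I) (n : nat) (n_ge1 : (1 <= n)%N) :
  (exists J, returns assp pdec incl I n J) /\
  (forall J, returns assp pdec incl I n J -> J = symbolic_power I n).
Proof.
have ret := returns_kept_components assp pdec incl I n.
split=> [|J /returns_unique/(_ ret) ->]; first by eexists; apply: ret.
have idIn := ideal_power_ideal I n.
have [decIn radE] := pdecP _ idIn; have [prIn _] := decIn.
have keptP c : c \in pdec (ideal_power I n) ->
    has (incl c.2) (assp I) <->
    exists2 p, associated_prime I p & radical c.1 `<=` p.
  move=> cD; rewrite (radE _ cD).
  have [idQ _ _] : primary_ideal c.1 by apply: prIn; apply: map_f.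
  have inclE p : associated_prime I p ->
      incl (radical c.1) p <-> radical c.1 `<=` p.
    move=> /associated_prime_prime[idp _ _].
    by apply: inclP => //; apply: radical_ideal.
  split=> [/hasP[p /(asspP _ idealI) pI /(inclE _ pI) cp]|[p pI cp]].
    by exists p.
  by apply/hasP; exists p; [apply/(asspP _ idealI) | apply/(inclE _ pI)].
apply/seteqP; split=> x.
  move=> /bigsetI_seqP xD p pI.
  apply/(contraction_extension_primary _ (associated_prime_prime pI) idIn decIn).
  move=> _ /mapP[c cD ->] cp; have := xD _ cD.
  by have -> : has (incl c.2) (assp I) by apply/keptP => //; exists p.
move=> xI; apply/bigsetI_seqP => c cD; case: ifPn => // /(keptP _ cD)[p pI cp].
have := xI p pI.
move/(contraction_extension_primary _ (associated_prime_prime pI) idIn decIn).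
by apply=> //; apply: map_f.
Qed.
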